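(* For integers $m_1,m_2\ge 2$, let $G_1$ be the star graph $K_{1,m_1}$ of order $m_1+1$ and $G_2$ the star graph $K_{1,m_2}$ of order $m_2+1$. Then $\mathrm{fix}(G_1*G_2)=m_1m_2+m_1+m_2-3$.
   Context: All graphs are finite and simple. For graphs $G_1,G_2$, the co-normal product $G_1*G_2$ is the graph with vertex set $V(G_1)\times V(G_2)$ in which $(a,b)$ and $(c,d)$ are adjacent if and only if $a$ is adjacent to $c$ in $G_1$ or $b$ is adjacent to $d$ in $G_2$. A set $F\subseteq V(G)$ is a fixing set of $G$ if the only automorphism of $G$ fixing every vertex of $F$ is the identity; $\mathrm{fix}(G)$ is the minimum cardinality of a fixing set. *)

(* Defs.v *)
From mathcomp Require Import all_boot all_fingroup.

Set Implicit Arguments.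
Unset Strict Implicit.
Unset Printing Implicit Defensive.

Record sgraph := SGraph {
  vertex :> finType;
  adj : rel vertex;
  adj_sym : symmetric adj;
  adj_irrefl : irreflexive adj }.

Section FixingNumber.
Variable G : sgraph.

Definition automorphism (s : {perm G}) : bool :=
  [forall x, forall y, adj (s x) (s y) == adj x y].

Definition fixing_set (F : {set G}) : bool :=
  [forall s : {perm G},
    automorphism s && [forall x in F, s x == x] ==> (s == 1%g)].

Lemma fixing_setT : fixing_set [set: G].
Proof.
apply/forallP => s; apply/implyP => /andP[_ /forall_inP sT].
by apply/eqP/permP => x; rewrite perm1; apply/eqP/sT; rewrite inE.
Qed.

(* [arg min] is meaningful here because [setT] is a fixing set. *)
Definition fixing_number : nat :=
  #|[arg min_(F < [set: G] | fixing_set F) #|F|]|.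

Lemma fixing_number_min F : fixing_set F -> fixing_number <= #|F|.
Proof.
by rewrite /fixing_number; case: arg_minnP => [|F0 _]; [exact: fixing_setT|apply].
Qed.

Lemma fixing_number_attained :
  exists2 F, fixing_set F & #|F| = fixing_number.
Proof.
rewrite /fixing_number; case: arg_minnP => [|F0 F0fix _]; first exact: fixing_setT.
by exists F0.
Qed.

End FixingNumber.

Section ConormalProduct.
Variables G1 G2 : sgraph.

Definition conormal_adj : rel (G1 * G2) :=
  fun u v => adj u.1 v.1 || adj u.2 v.2.

Lemma conormal_adj_sym : symmetric conormal_adj.
Proof. by move=> u v; rewrite /conormal_adj adj_sym [adj u.2 _]adj_sym. Qed.

Lemma conormal_adj_irrefl : irreflexive conormal_adj.
Proof. by move=> u; rewrite /conormal_adj !adj_irrefl. Qed.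

Definition conormal : sgraph := SGraph conormal_adj_sym conormal_adj_irrefl.

End ConormalProduct.

Section CompleteBipartite.
Variables m n : nat.

Definition bipartite_adj : rel ('I_m + 'I_n) :=
  fun u v => match u, v with
             | inl _, inr _ | inr _, inl _ => true
             | _, _ => false
             end.

Lemma bipartite_adj_sym : symmetric bipartite_adj.
Proof. by case=> ? []. Qed.

Lemma bipartite_adj_irrefl : irreflexive bipartite_adj.
Proof. by case. Qed.

Definition complete_bipartite : sgraph :=
  SGraph bipartite_adj_sym bipartite_adj_irrefl.

End CompleteBipartite.

Definition star (m : nat) : sgraph := complete_bipartite 1 m.

Lemma card_star m : #|star m| = m.+1.
Proof. by rewrite card_sum !card_ord. Qed.

(* Main.v *)
Require Import Defs.
From mathcomp Require Import all_boot all_fingroup.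

(** Two vertices of a star are adjacent exactly when one is the centre and the
    other is not, so the co-normal product of two stars is complete multipartite,
    with the four parts {centre, leaf} x {centre, leaf}.  A fixing set misses at
    most one vertex of each part, since two missed vertices of the same part
    could be swapped.  Conversely, a set missing exactly one vertex of each part
    is fixing: every part other than the singleton (centre, centre) has a fixed
    vertex, hence is preserved. *)

Section CompleteMultipartite.
Variables (G : sgraph) (K : finType) (k : G -> K).
Hypothesis adjE : forall u v : G, adj u v = (k u != k v).

Lemma multipartite_automorphismP (s : {perm G}) :
  reflect (forall u v, (k (s u) == k (s v)) = (k u == k v)) (automorphism s).
Proof.
apply: (iffP forallP) => [sA u v | sA u].
  by have /forallP/(_ v) := sA u; rewrite !adjE => /eqP/negb_inj.
by apply/forallP => v; rewrite !adjE sA.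
Qed.

Lemma fixing_set_inj (F : {set G}) : fixing_set F -> {in ~: F &, injective k}.
Proof.
move=> /forallP Ffix u v; rewrite !inE => uF vF kuv; apply/eqP.
have ktperm x : k (tperm u v x) = k x by case: tpermP => [->|->|].
have /implyP := Ffix (tperm u v).
have -> /= : automorphism (tperm u v).
  by apply/multipartite_automorphismP => x y; rewrite !ktperm.
have -> /= : [forall x in F, tperm u v x == x].
  apply/forall_inP => x xF; rewrite tpermD //.
    by apply: contra uF => /eqP ->.
  by apply: contra vF => /eqP ->.
by move=> /(_ isT)/eqP/permP/(_ v); rewrite tpermR perm1 => ->.
Qed.

(** Since [k] is injective on the complement of [F], at most [#|K|] vertices are missed. *)
Lemma card_fixing_set (F : {set G}) : fixing_set F -> #|G| - #|K| <= #|F|.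
Proof.
move=> /fixing_set_inj /card_in_imset kF.
by rewrite leq_subLR addnC -(cardsC F) leq_add2l -kF max_card.
Qed.

Variables (r : K -> G) (t0 : K).
Hypothesis rK : cancel r k.
Hypothesis twin : forall t, t != t0 -> exists2 y, y != r t & k y = t.

(** Here [r] chooses the omitted vertex of each part, and [t0] is the one part that may be a
    singleton. *)
Lemma fixing_set_transversalC : fixing_set (~: [set r t | t : K]).
Proof.
apply/forallP => s; apply/implyP => /andP[/multipartite_automorphismP sA].
move=> /forall_inP sF.
have s_out x : x != r (k x) -> s x = x.
  move=> xr; apply/eqP/sF; rewrite inE; apply: contra xr.
  by case/imsetP => t _ ->; rewrite rK.
have s_r t : t != t0 -> s (r t) = r t.
  move=> /twin[y yr ky].
  have /eqP ks : k (s (r t)) == t.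
    (* The twin [y] shares the part of [r t] and is fixed by [s], so [s] keeps [r t] in that
       part. *)
    by rewrite -{2}ky -(s_out y) ?ky // sA rK ky.
  have [-> | sr] := eqVneq (s (r t)) (r t); first by [].
  (* Otherwise [s (r t)] is not the chosen vertex of its part, so [s] fixes it, and injectivity of
     [s] gives [s (r t) = r t]. *)
  by apply: (@perm_inj _ s); apply: s_out; rewrite ks.
have s_id x : x != r t0 -> s x = x.
  have [xE | /s_out //] := eqVneq x (r (k x)).
  by rewrite xE (inj_eq (can_inj rK)) => /s_r.
apply/eqP/permP => x; rewrite perm1; have [-> | /s_id //] := eqVneq x (r t0).
(* Only [r t0] could still move, and a permutation cannot move exactly one point. *)
have [// | sr] := eqVneq (s (r t0)) (r t0).
by apply: (@perm_inj _ s); apply: s_id.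
Qed.

Lemma fixing_number_multipartite : fixing_number G = #|G| - #|K|.
Proof.
apply/eqP; rewrite eqn_leq; apply/andP; split.
  apply: leq_trans (fixing_number_min fixing_set_transversalC) _.
  by rewrite cardsCs setCK card_imset //; apply: can_inj rK.
by have [F /card_fixing_set ? <-] := fixing_number_attained G.
Qed.

End CompleteMultipartite.

Definition is_center {m} (u : star m) : bool := if u is inl _ then true else false.

Lemma star_adjE m (u v : star m) : adj u v = (is_center u != is_center v).
Proof. by case: u v => ? []. Qed.

Theorem theorem3p16 (m1 m2 : nat) (hm1 : 2 <= m1) (hm2 : 2 <= m2) :
  fixing_number (conormal (star m1) (star m2)) = m1 * m2 + m1 + m2 - 3.
Proof.
case: m1 hm1 => [|[|m1]] // _; case: m2 hm2 => [|[|m2]] // _.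
pose k (u : conormal (star m1.+2) (star m2.+2)) := (is_center u.1, is_center u.2).
pose vtx m (i : 'I_m.+2) (c : bool) : star m.+2 := if c then inl ord0 else inr i.
have vtxK m i : cancel (@vtx m i) is_center by case.
pose r (t : bool * bool) : conormal (star m1.+2) (star m2.+2) :=
  (vtx m1 ord0 t.1, vtx m2 ord0 t.2).
rewrite (@fixing_number_multipartite _ _ k _ r (true, true)).
- rewrite !card_prod card_bool !card_star mulSn mulnS.
  (* For a and b leaves, (a + 1)(b + 1) = ab + a + b + 1; the 1 cancels one of the four parts,
     leaving 3 to subtract. *)
  by rewrite -[2 * 2]/(1 + 3) subnDA addSn subn1 /= addnC [m1.+2 + _]addnC.
- by move=> u v; rewrite /= /conormal_adj !star_adjE -negb_and.
- by case=> a b; rewrite /k /= !vtxK.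
(* The leaf [ord_max] differs from the leaf [ord0] used by [r], as each star has at least two
   leaves; so every part with a leaf coordinate has a second vertex. *)
case=> a b ab; exists (vtx m1 ord_max a, vtx m2 ord_max b); last by rewrite /k /= !vtxK.
by case: a b ab => [] [].
Qed.
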